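(* Let $k\ge1$ be an integer and let $I\subset S=K[x_1,\ldots,x_n]$ ($K$ a field) be a $k$-Borel ideal. Then $I$ has a regular decomposition function; that is, there is an order $u_1,\ldots,u_m$ of $G(I)$ with respect to which $I$ has linear quotients and whose decomposition function $g$ is regular.
   Context: For a monomial ideal $I$, $G(I)$ is its unique minimal set of monomial generators; $\operatorname{supp}(u)=\{i: x_i\mid u\}$. A monomial $u=x_1^{a_1}\cdots x_n^{a_n}$ is $k$-bounded if $a_i\le k$ for all $i$; a monomial ideal is $k$-bounded if it is generated by $k$-bounded monomials. A $k$-bounded monomial ideal $I$ is $k$-Borel if for every $k$-bounded monomial $u\in I$, every $j\in\operatorname{supp}(u)$ and every $i<j$ one has $x_i(u/x_j)\in I$, provided $x_i(u/x_j)$ is $k$-bounded. A monomial ideal $I$ with $G(I)=\{u_1,\ldots,u_m\}$ has linear quotients with respect to the order $u_1,\ldots,u_m$ if for every $2\le j\le m$ the colon ideal $(u_1,\ldots,u_{j-1}):(u_j)$ is generated by a subset of the variables. In this case put $\operatorname{set}(u_j)=\{i: x_i\in(u_1,\ldots,u_{j-1}):(u_j)\}$ (so $\operatorname{set}(u_1)=\emptyset$). Let $M(I)$ be the set of all monomials in $I$. The decomposition function (for the given order) is the map $g:M(I)\to G(I)$ with $g(u)=u_j$, where $j$ is the smallest number such that $u\in(u_1,\ldots,u_j)$. It is called regular if $\operatorname{set}(g(x_su))\subseteq\operatorname{set}(u)$ for every $u\in G(I)$ and every $s\in\operatorname{set}(u)$. *)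

(* Defs.v *)
From mathcomp Require Import all_boot all_order all_algebra.
From mathcomp Require Export mpoly.

Set Implicit Arguments.
Unset Strict Implicit.
Unset Printing Implicit Defensive.

Import GRing.Theory.
Local Open Scope ring_scope.

(* Ideals are Prop-valued predicates, compared extensionally. MathComp's
   [idealr] is not used because it excludes the unit ideal, and (1) is
   k-Borel. *)
Section Ideals.
Variable R : comNzRingType.

Definition same_set (T : Type) (A B : T -> Prop) : Prop :=
  forall x, A x <-> B x.

Definition ideal_gen (A : R -> Prop) (p : R) : Prop :=
  exists2 s : seq (R * R),
    (forall c, c \in s -> A c.2) & p = \sum_(c <- s) c.1 * c.2.

Definition colon (J L : R -> Prop) (p : R) : Prop :=
  forall q, L q -> J (p * q).

End Ideals.

Section MonomialIdeals.
Variables (K : fieldType) (n : nat).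

Implicit Types (I : {mpoly K[n]} -> Prop) (A : 'X_{1..n} -> Prop).

Definition monomial_ideal_gen A : {mpoly K[n]} -> Prop :=
  ideal_gen (fun p => exists2 m, A m & p = 'X_[m]).

Definition var_ideal_gen (V : {set 'I_n}) : {mpoly K[n]} -> Prop :=
  ideal_gen (fun p => exists2 i, i \in V & p = 'X_i).

(* [A] is G(I): a set of monomials generating I, minimal for inclusion among
   such sets. *)
Definition is_min_mon_gens I A : Prop :=
  same_set I (monomial_ideal_gen A) /\
  forall B : 'X_{1..n} -> Prop, (forall m, B m -> A m) ->
    same_set I (monomial_ideal_gen B) -> forall m, A m -> B m.

(* On 'X_{1..n}, [(m1 <= m2)%MM] is divisibility of monomials. *)
Definition mon_supp (m : 'X_{1..n}) : {set 'I_n} :=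
  [set i | (U_(i) <= m)%MM].

Definition k_bounded_mon (k : nat) (m : 'X_{1..n}) : Prop :=
  forall i, (m i <= k)%N.

Definition k_bounded_ideal (k : nat) I : Prop :=
  exists2 A : 'X_{1..n} -> Prop,
    (forall m, A m -> k_bounded_mon k m) &
    same_set I (monomial_ideal_gen A).

Definition k_Borel (k : nat) I : Prop :=
  k_bounded_ideal k I /\
  forall (u : 'X_{1..n}) (i j : 'I_n),
    k_bounded_mon k u -> I 'X_[u] -> j \in mon_supp u -> (i < j)%N ->
    k_bounded_mon k (U_(i) + (u - U_(j)))%MM ->
    I 'X_[(U_(i) + (u - U_(j)))%MM].

Section Orders.
(* [us] lists u_1, ..., u_m; indices are shifted to start at 0. *)
Variable us : seq 'X_{1..n}.

Definition initial_ideal (j : nat) : {mpoly K[n]} -> Prop :=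
  monomial_ideal_gen (fun m => m \in take j us).

Definition initial_colon (j : nat) : {mpoly K[n]} -> Prop :=
  colon (initial_ideal j)
        (monomial_ideal_gen (fun m => m = nth 0%MM us j)).

Definition linear_quotients : Prop :=
  forall j, (0 < j < size us)%N ->
    exists V : {set 'I_n}, same_set (initial_colon j) (var_ideal_gen V).

(* set(u), for [u] a member of the duplicate-free list [us]; it is empty for
   the first member, since the zero ideal colon (u_1) is zero. *)
Definition lq_set (u : 'X_{1..n}) (i : 'I_n) : Prop :=
  initial_colon (index u us) 'X_i.

(* The values of [g] outside M(I) are irrelevant. *)
Definition decomposition_function I (g : 'X_{1..n} -> 'X_{1..n}) : Prop :=
  forall m, I 'X_[m] ->
    exists j, [/\ (j < size us)%N, g m = nth 0%MM us j,
      initial_ideal j.+1 'X_[m] &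
      forall l, (l < j)%N -> ~ initial_ideal l.+1 'X_[m]].

Definition regular_decomposition (g : 'X_{1..n} -> 'X_{1..n}) : Prop :=
  forall u s, u \in us -> lq_set u s ->
    forall t, lq_set (g (U_(s) + u)%MM) t -> lq_set u t.

End Orders.
End MonomialIdeals.

Arguments linear_quotients K {n} us.
Arguments lq_set K {n} us u i.
Arguments regular_decomposition K {n} us g.

(* Main.v *)
Require Import Defs.
From mathcomp Require Import all_boot all_order all_algebra mpoly.
From mathcomp Require Import zify.
From Stdlib Require Import Classical.

(** Order G(I) decreasingly for the lexicographic order with x_1 > ... > x_n
    (not by degree first).  For u in G(I) the claim is that
      set(u) = { i | u_i < k and u_j > 0 for some j > i },
    where u_i is the exponent of x_i; this set is [lq_vars].

    Everything rests on an exchange property ([min_mon_exchange]): if i is in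
    this set, witnessed by j, then some w in G(I) divides x_i u / x_j and is
    lexicographically larger than u.  The k-Borel condition puts x_i u / x_j in
    I, so some w in G(I) divides it.  Then w_i = u_i + 1, since otherwise w
    would be a proper divisor of u.  If w_l < u_l for some l < i, the k-Borel
    condition applied to w puts x_l w / x_i in I, but this monomial divides
    u / x_j, contradicting the minimality of u.  So w agrees with u before i.

    Linear quotients ([lex_colonP]): the exchange property shows that x_i, for
    i in [lq_vars u], lies in the colon ideal of u.  Conversely, if w in G(I)
    precedes u, the first index i where they differ is in [lq_vars u], because
    otherwise u would divide w; and x_i divides w / gcd(w, u).

    Regularity ([lq_vars_regular]): let v = g(x_s u) be the lexicographically
    largest generator dividing x_s u.  Then v_s = u_s + 1 and v_l <= u_l for the
    other l.  Let t be in [lq_vars v], with witness j.  A nonzero exponent of u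
    after t is easily found.  If u_t >= k > v_t, then x_t v / x_j still divides
    x_s u, and the exchange property for v gives a generator that divides
    x_s u and is larger than v, a contradiction. *)

Set Implicit Arguments.
Unset Strict Implicit.
Unset Printing Implicit Defensive.

Import GRing.Theory.

(** * Membership in monomial ideals *)

Section MonomialMembership.
Variables (K : fieldType) (n : nat).
Implicit Types (A : 'X_{1..n} -> Prop) (p : {mpoly K[n]}) (u m : 'X_{1..n}).
Local Open Scope ring_scope.

(** A polynomial lies in a monomial ideal exactly when each of its monomials
    is divisible by a generator; all ideal computations below reduce to
    divisibility of monomials through this lemma. *)
Lemma monomial_ideal_genP A p :
  monomial_ideal_gen A p <->
  forall m, m \in msupp p -> exists2 a, A a & (a <= m)%MM.
Proof.
split=> [[s sA ->] m /msupp_sum_le /flattenP[t /mapP[c]] | suppA].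
  rewrite mem_filter /= => cs -> {t}.
  have [a Aa ->] := sA c cs.
  rewrite (perm_mem (msuppMX _ _)) => /mapP[m' _ ->].
  by exists a; rewrite // lem_addr.
rewrite [p]mpolyE big_seq.
elim/big_ind: _ => [|q r [s sA ->] [t tA ->]|m /suppA[a Aa le_am]].
- by exists [::]; rewrite ?big_nil.
- exists (s ++ t); last by rewrite big_cat.
  by move=> c; rewrite mem_cat => /orP[/sA|/tA].
- exists [:: (p@_m *: 'X_[(m - a)%MM], 'X_[a])].
    by move=> c; rewrite inE => /eqP-> /=; exists a.
  by rewrite big_seq1 /= -scalerAl -mpolyXD submK.
Qed.

Lemma monomial_ideal_genX A m :
  monomial_ideal_gen A ('X_[m] : {mpoly K[n]}) <->
  exists2 a, A a & (a <= m)%MM.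
Proof.
rewrite monomial_ideal_genP msuppX; split=> [|exA m']; last first.
  by rewrite inE => /eqP->.
by apply; rewrite inE.
Qed.

Lemma var_ideal_genP (V : {set 'I_n}) p :
  var_ideal_gen V p <->
  forall m, m \in msupp p -> exists2 i, i \in V & (U_(i) <= m)%MM.
Proof.
have -> : (forall m, m \in msupp p -> exists2 i, i \in V & (U_(i) <= m)%MM)
    <-> monomial_ideal_gen (fun a => exists2 i, i \in V & a = U_(i)%MM) p.
  rewrite monomial_ideal_genP; split=> H m /H.
    by move=> [i Vi le_im]; exists U_(i)%MM => //; exists i.
  by move=> [_ [i Vi ->] le_im]; exists i.
split=> -[s sA ->]; exists s => // c /sA.
  by move=> [i Vi ->]; exists U_(i)%MM => //; exists i.
by move=> [_ [i Vi ->] ->]; exists i.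
Qed.

Lemma colon_monomialP A u p :
  colon (monomial_ideal_gen A) (monomial_ideal_gen (fun m => m = u)) p <->
  forall m, m \in msupp p -> exists2 a, A a & (a <= m + u)%MM.
Proof.
have -> : colon (monomial_ideal_gen A) (monomial_ideal_gen (fun m => m = u)) p
          <-> monomial_ideal_gen A (p * 'X_[u]).
  split=> [|pA q [s su ->]].
    by apply; apply/monomial_ideal_genX; exists u => //; apply: lepm_refl.
  apply/monomial_ideal_genP => m; rewrite big_distrr /=.
  move=> /msupp_sum_le /flattenP[t /mapP[c]].
  rewrite mem_filter /= => /su[_ -> ->] -> {t}.
  rewrite mulrCA mulrC => /msuppM_le/allpairsP[[m1 m2] /= [m1p _ ->]].
  have [a Aa le_am] := (monomial_ideal_genP _ _).1 pA _ m1p.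
  by exists a; rewrite // (lepm_trans le_am) // lem_addr.
rewrite monomial_ideal_genP; split=> H m.
  move=> mp; apply: H; rewrite (perm_mem (msuppMX _ _)).
  by apply/mapP; exists m; rewrite // addmC.
by rewrite (perm_mem (msuppMX _ _)) => /mapP[m' /H m'A ->]; rewrite addmC.
Qed.

End MonomialMembership.

(** * Exchange in the minimal generators of a k-Borel set of monomials *)

Section KBorelMonomials.
Variables (n k : nat) (P : 'X_{1..n} -> Prop).
Implicit Types (u v w a m : 'X_{1..n}) (i j l s t : 'I_n).

(** Minimality for divisibility among the monomials satisfying [P]; when [P] is
    membership in a monomial ideal I, these are the elements of G(I). *)
Definition min_mon m : Prop := P m /\ forall a, P a -> (a <= m)%MM -> a = m.

Hypothesis P_bounded : forall m, min_mon m -> k_bounded_mon k m.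
Hypothesis P_exchange : forall u i j,
  k_bounded_mon k u -> P u -> 0 < u j -> i < j ->
  k_bounded_mon k (U_(i) + (u - U_(j)))%MM -> P (U_(i) + (u - U_(j)))%MM.

Lemma min_mon_below m : P m -> exists2 a, min_mon a & (a <= m)%MM.
Proof.
have [d] := ubnP (mdeg m); elim: d m => // d IHd m lt_md Pm.
case: (classic (exists2 a, P a & (a <= m)%MM /\ a <> m)); last first.
  move=> no_a; exists m; last exact: lepm_refl.
  split=> // a Pa le_am.
  by apply: NNPP => ne_am; apply: no_a; exists a.
move=> [a Pa [le_am ne_am]].
have lt_am : mdeg a < mdeg m.
  rewrite -(submK le_am) mdegD -[X in X < _]add0n ltn_add2r lt0n mdeg_eq0.
  by apply: contra_notN ne_am => /eqP E; rewrite -(submK le_am) E add0m.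
have [|b min_b le_ba] := IHd a _ Pa; first by lia.
by exists b; rewrite // (lepm_trans le_ba).
Qed.

(** Lexicographic order on exponent vectors, the exponent of the first variable
    being compared first. *)
Definition lexlt u v : bool := ((u : n.-tuplelexi nat) < v)%O.

Lemma lexltP u v :
  reflect (exists2 i : 'I_n, forall l : 'I_n, l < i -> u l = v l & u i < v i)
          (lexlt u v).
Proof. exact: Order.TupleLexiOrder.ltxi_tuplePlt. Qed.

(** The explicit description of set(u): the indices before the last variable of
    u at which the exponent of u can still be raised within the bound k. *)
Definition lq_vars u : {set 'I_n} :=
  [set i | (u i < k) && [exists j : 'I_n, (i < j) && (0 < u j)]].

Lemma lq_varsP u i :
  reflect (u i < k /\ exists2 j : 'I_n, i < j & 0 < u j) (i \in lq_vars u).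
Proof.
rewrite inE; apply: (iffP andP) => -[lt_uk].
  by case/existsP=> j /andP[ij uj]; split=> //; exists j.
by case=> j ij uj; split=> //; apply/existsP; exists j; rewrite ij.
Qed.

(** Each index of [lq_vars u] produces a minimal monomial that is
    lexicographically larger than u. *)
Lemma min_mon_exchange u i j :
  min_mon u -> u i < k -> i < j -> 0 < u j ->
  exists w, [/\ min_mon w, (w <= U_(i) + (u - U_(j)))%MM & lexlt u w].
Proof.
move=> min_u lt_uk lt_ij uj.
have bd_u := P_bounded min_u.
have E l : (U_(i) + (u - U_(j)))%MM l = (i == l) + (u l - (j == l)).
  by rewrite mnmDE mnmBE !mnm1E.
have ne_ji : (j == i) = false by apply/eqP => ji; rewrite ji ltnn in lt_ij.
have bd_x : k_bounded_mon k (U_(i) + (u - U_(j)))%MM.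
  move=> l; rewrite E; case: eqVneq => [<-|_]; first by rewrite ne_ji; lia.
  by have := bd_u l; lia.
have [w min_w le_wx] := min_mon_below (P_exchange bd_u min_u.1 uj lt_ij bd_x).
have le_w l : w l <= (i == l) + (u l - (j == l)).
  by rewrite -E; apply: (mnm_lepP le_wx).
exists w; split=> //.
have wi : w i = (u i).+1.
  have := le_w i; rewrite eqxx ne_ji subn0 add1n leq_eqVlt => /orP[/eqP//|lt_w].
  (* otherwise w divides u / x_j, against the minimality of u *)
  have /(min_u.2 _ min_w.1) wu : (w <= u)%MM.
    by apply/mnm_lepP=> l; have := le_w l; case: eqVneq => [<-|_]; lia.
  by have := le_w j; rewrite wu eqxx eq_sym ne_ji; lia.
apply/lexltP; exists i; last by rewrite wi.
move=> l lt_li; apply/eqP; rewrite eqn_leq andbC.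
have ne_il : (i == l) = false by apply/eqP => il; rewrite il ltnn in lt_li.
have le_wl : w l <= u l by have := le_w l; rewrite ne_il; lia.
rewrite le_wl leqNgt; apply/negP => lt_wl.
have bd_w := P_bounded min_w.
have F t : (U_(l) + (w - U_(i)))%MM t = (l == t) + (w t - (i == t)).
  by rewrite mnmDE mnmBE !mnm1E.
(* x_l w / x_i would be a proper divisor of u lying in P *)
have bd_y : k_bounded_mon k (U_(l) + (w - U_(i)))%MM.
  move=> t; rewrite F; case: eqVneq => [<-|_]; last by have := bd_w t; lia.
  by have := bd_u l; lia.
have Py : P (U_(l) + (w - U_(i)))%MM.
  by apply: P_exchange => //; [exact: min_w.1 | rewrite wi].
have ne_lj : (l == j) = false.
  by apply/eqP => lj; rewrite lj in lt_li; lia.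
have yu : (U_(l) + (w - U_(i)))%MM = u.
  apply: (min_u.2 _ Py); apply/mnm_lepP => t; rewrite F.
  case: (eqVneq l t) => [<-|_]; first by lia.
  by have := le_w t; case: eqVneq => [<-|_]; lia.
have := F j; rewrite yu ne_lj.
by have := le_w j; rewrite eqxx eq_sym ne_ji; lia.
Qed.

(** A minimal monomial larger than u first differs from u at an index of
    [lq_vars u]. *)
Lemma lexlt_first_diff u v :
  min_mon u -> min_mon v -> lexlt u v ->
  exists i, [/\ i \in lq_vars u, u i < v i & forall l, l < i -> u l = v l].
Proof.
move=> min_u min_v /lexltP[i eq_uv lt_uv]; exists i; split=> //.
apply/lq_varsP; split; first by have := P_bounded min_v i; lia.
apply: NNPP => no_j.
(* otherwise u is supported on indices <= i, hence divides v *)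
suff uv : u = v by rewrite uv ltnn in lt_uv.
apply: (min_v.2 _ min_u.1); apply/mnm_lepP => l.
case: (ltngtP l i) => [/eq_uv->//|il|/val_inj->]; last by lia.
by case: (posnP (u l)) => [->//|ul]; case: no_j; exists l.
Qed.

(** The monomials m with m u in the ideal of the generators preceding u are
    those divisible by a variable of [lq_vars u]. *)
Lemma lex_colonP u m :
  min_mon u ->
  (exists w, [/\ min_mon w, lexlt u w & (w <= m + u)%MM]) <->
  exists2 i, i \in lq_vars u & (U_(i) <= m)%MM.
Proof.
move=> min_u; split=> [[w [min_w lt_uw le_w]] | [i /lq_varsP[uk [j ij uj]] im]].
  have [i [Vi lt_i _]] := lexlt_first_diff min_u min_w lt_uw.
  exists i => //; apply/mnm_lepP => l; rewrite mnm1E.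
  have := mnm_lepP le_w l; rewrite mnmDE.
  by case: eqVneq => [<-|_]; lia.
have [w [min_w le_w lt_uw]] := min_mon_exchange min_u uk ij uj.
exists w; split=> //; apply/mnm_lepP => l.
have := mnm_lepP le_w l; have := mnm_lepP im l.
by rewrite !mnmDE mnmBE; lia.
Qed.

(** Regularity: if v is the lexicographically largest minimal generator
    dividing x_s u, then the exchange lemma applied to v forces each variable
    of [lq_vars v] to be one of [lq_vars u]. *)
Lemma lq_vars_regular u v s :
  min_mon u -> min_mon v -> s \in lq_vars u -> (v <= U_(s) + u)%MM ->
  (forall w, min_mon w -> (w <= U_(s) + u)%MM -> ~~ lexlt v w) ->
  lexlt u v -> {subset lq_vars v <= lq_vars u}.
Proof.
move=> min_u min_v /lq_varsP[usk [s' ss' us']] le_v max_v lt_uv t.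
have {}le_v l : v l <= (s == l) + u l.
  by have := mnm_lepP le_v l; rewrite mnmDE mnm1E.
have [i [_ lt_i _]] := lexlt_first_diff min_u min_v lt_uv.
(* v_i > u_i, while v divides x_s u *)
have si : s = i by apply/eqP; have := le_v i; case: eqVneq => // _; lia.
rewrite -{i}si in lt_i.
move=> /lq_varsP[vtk [j tj vj]]; apply/lq_varsP; split; last first.
  case: (eqVneq s j) => [sj|ne_sj].
    by exists s' => //; rewrite -sj in tj; lia.
  by exists j => //; have := le_v j; rewrite (negPf ne_sj); lia.
rewrite ltnNge; apply/negP => le_kut.
(* v_t < k <= u_t, so a divisor of x_t v / x_j still divides x_s u *)
have [w [min_w le_w lt_vw]] := min_mon_exchange min_v vtk tj vj.
suff /(max_v _ min_w) : (w <= U_(s) + u)%MM by rewrite lt_vw.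
apply/mnm_lepP => l; have := mnm_lepP le_w l; rewrite !mnmDE mnmBE !mnm1E.
by case: (eqVneq t l) => [<-|_]; have := le_v l; lia.
Qed.

(** * The lexicographically decreasing list of minimal monomials *)

Lemma bounded_mon_seq : exists s : seq 'X_{1..n},
  forall m, k_bounded_mon k m -> m \in s.
Proof.
exists [seq [multinom (f i : nat) | i < n] | f : {ffun 'I_n -> 'I_k.+1}].
move=> m bd_m; apply/imageP.
exists [ffun i => inord (m i)] => //.
by apply/mnmP => i; rewrite mnmE ffunE inordK // ltnS.
Qed.

(** Filtering by an undecidable predicate; excluded middle makes the result
    exist, although it cannot be computed. *)
Lemma filter_Prop (T : eqType) (Q : T -> Prop) (s : seq T) :
  exists s' : seq T, forall x, x \in s' <-> x \in s /\ Q x.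
Proof.
elim: s => [|x s [s' s'P]]; first by exists [::] => x; split=> [|[]].
case: (classic (Q x)) => [Qx|nQx].
  exists (x :: s') => y; rewrite !inE; split.
    by case/orP=> [/eqP->|/s'P[-> Qy]]; rewrite ?eqxx ?orbT.
  by case=> /orP[->//|ys Qy]; apply/orP; right; apply/s'P.
exists s' => y; rewrite s'P inE; split=> [[-> Qy]|]; first by rewrite orbT.
by case=> /orP[/eqP->|].
Qed.

(** The minimal monomials are finitely many because they are k-bounded, so they
    can be listed with the lexicographically larger ones first. *)
Lemma min_mon_lex_seq : exists us : seq 'X_{1..n},
  [/\ uniq us, forall m, m \in us <-> min_mon m &
      {in us &, forall u w, (index w us < index u us) = lexlt u w}].
Proof.
have [s sP] := bounded_mon_seq.
have [s' s'P] := filter_Prop min_mon s.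
pose ge : rel 'X_{1..n} := fun u w => ((w : n.-tuplelexi nat) <= u)%O.
have ge_tr : transitive ge by move=> a b c /= ba ac; apply: Order.le_trans ac ba.
have ge_tot : total ge by move=> a b; apply: Order.le_total.
pose us := sort ge (undup s').
have us_uniq : uniq us by rewrite sort_uniq undup_uniq.
exists us; split=> // [m|u w uus wus].
  rewrite mem_sort mem_undup s'P; split=> [[]//|min_m]; split=> //.
  exact/sP/P_bounded.
have us_sorted : sorted ge us by apply: sort_sorted.
have ge_refl : reflexive ge by move=> a; apply: Order.le_refl.
case: (ltngtP (index w us) (index u us)) => [lt_i|gt_i|eq_i].
- have := sorted_leq_index ge_tr ge_refl us_sorted _ _ wus uus (ltnW lt_i).
  rewrite /ge Order.POrderTheory.le_eqVlt -/(lexlt u w) =>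
      /orP[/eqP/val_inj uw|->//].
  by rewrite uw ltnn in lt_i.
- have := sorted_leq_index ge_tr ge_refl us_sorted _ _ uus wus (ltnW gt_i).
  by rewrite /lexlt /ge Order.TotalTheory.leNgt => /negPf->.
- rewrite -(nth_index u uus) -eq_i nth_index //.
  by rewrite /lexlt Order.POrderTheory.ltxx.
Qed.

End KBorelMonomials.

(** * Regular decomposition functions of k-Borel ideals *)

Theorem proposition2p7 (K : fieldType) (n k : nat) (hk : (1 <= k)%N)
    (I : {mpoly K[n]} -> Prop) (hI : k_Borel k I) :
  exists us : seq 'X_{1..n},
    [/\ uniq us,
        is_min_mon_gens I (fun m => m \in us),
        linear_quotients K us &
        exists2 g : 'X_{1..n} -> 'X_{1..n},
          decomposition_function us I g & regular_decomposition K us g].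
Proof.
case: hI => -[A A_bd IA] I_exch.
pose P m := I 'X_[m].
have PA m : P m <-> exists2 a, A a & (a <= m)%MM.
  by rewrite /P IA monomial_ideal_genX.
have P_up a m : P a -> (a <= m)%MM -> P m.
  move/PA => [b Ab le_ba] le_am; apply/PA; exists b => //.
  exact: lepm_trans le_am.
have P_bd m : min_mon P m -> k_bounded_mon k m.
  move=> [/PA[a Aa le_am] min_m]; rewrite -(min_m a) //; first exact: A_bd.
  by apply/PA; exists a => //; apply: lepm_refl.
have P_ex u (i j : 'I_n) : k_bounded_mon k u -> P u -> 0 < u j -> i < j ->
    k_bounded_mon k (U_(i) + (u - U_(j)))%MM -> P (U_(i) + (u - U_(j)))%MM.
  move=> bd_u Pu uj; apply: I_exch => //; rewrite inE.
  by apply/mnm_lepP => l; rewrite mnm1E; case: eqVneq => [<-|].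
have [us [us_uniq us_min us_lex]] := min_mon_lex_seq P_bd.
exists us.
have us_below m : P m -> exists2 a, a \in us & (a <= m)%MM.
  by move/min_mon_below => [a /us_min aus le_am]; exists a.
have initP j m : initial_ideal us j ('X_[m] : {mpoly K[n]}) <->
    exists2 a, a \in take j us & (a <= m)%MM by exact: monomial_ideal_genX.
have colonP u p : u \in us -> initial_colon us (index u us) p <->
    var_ideal_gen (K := K) (lq_vars k u) p.
  move=> uus; rewrite /initial_colon nth_index // /initial_ideal.
  rewrite colon_monomialP var_ideal_genP.
  have colon_m m : (exists2 a, a \in take (index u us) us & (a <= m + u)%MM)
      <-> exists2 i, i \in lq_vars k u & (U_(i) <= m)%MM.
    rewrite -(lex_colonP P_bd P_ex) //; last exact/us_min.
    split=> [[a a_u le_a]|[a [/us_min aus lt_ua le_a]]].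
      have aus := mem_take a_u.
      by exists a; split=> //; [exact/us_min | rewrite -us_lex // -in_take].
    by exists a; rewrite // in_take // us_lex.
  by split=> H m /H /colon_m.
have lq_setP u (i : 'I_n) : u \in us -> lq_set K us u i <-> i \in lq_vars k u.
  move=> uus; rewrite /lq_set colonP // var_ideal_genP msuppX.
  split=> [/(_ U_(i)%MM)|Vi m].
    rewrite inE eqxx => /(_ isT)[l Vl /mnm_lepP/(_ l)].
    by rewrite !mnm1E eqxx; case: eqVneq => [->|].
  by rewrite inE => /eqP->; exists i => //; apply: lepm_refl.
split=> //.
- split=> [p|B B_us IB m mus].
    rewrite IA !monomial_ideal_genP; split=> H m /H.
      by move/PA/us_below.
    by move=> [a /us_min[Pa _] le_am]; apply/PA/(P_up a).
  have [Pm min_m] := (us_min m).1 mus.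
  have [b Bb le_bm] := (monomial_ideal_genX _ _ _).1 ((IB _).1 Pm).
  by rewrite -(min_m b) //; apply: ((us_min b).1 (B_us b Bb)).1.
- move=> j /andP[_ lt_j]; exists (lq_vars k (nth 0%MM us j)) => p.
  by rewrite -colonP ?mem_nth // index_uniq.
(* the first generator in the list dividing m *)
pose g m := nth 0%MM us (find (fun w => (w <= m)%MM) us).
have g_least m : P m -> let j := find (fun w => (w <= m)%MM) us in
    [/\ j < size us, (g m <= m)%MM &
        forall w, w \in us -> (w <= m)%MM -> j <= index w us].
  move=> /us_below[a aus le_am] j.
  have has_m : has (fun w => (w <= m)%MM) us by apply/hasP; exists a.
  split; first by rewrite -has_find.
    exact: (nth_find _ has_m).
  move=> w wus le_wm; rewrite leqNgt; apply/negP => /(before_find 0%MM).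
  by rewrite nth_index // le_wm.
exists g => [m Pm|u s uus /(lq_setP _ _ uus) Vs t].
  have [lt_j le_g j_min] := g_least m Pm.
  exists (find (fun w => (w <= m)%MM) us); split=> //.
    apply/initP; exists (g m) => //.
    by rewrite in_take ?index_uniq ?mem_nth.
  move=> l lt_l /initP[a a_l le_a].
  have aus := mem_take a_l; have := j_min a aus le_a.
  by move: a_l; rewrite in_take // ltnS; lia.
have [Pu _] := (us_min u).1 uus.
have [|lt_j le_g j_min] := g_least (U_(s) + u)%MM.
  by apply: (P_up u) => //; apply: lem_addl.
have gus : g (U_(s) + u)%MM \in us by apply: mem_nth.
have g_max w : min_mon P w -> (w <= U_(s) + u)%MM ->
    ~~ lexlt (g (U_(s) + u)%MM) w.
  move=> /us_min wus le_w.
  by rewrite -us_lex // index_uniq // -leqNgt; apply: j_min.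
rewrite !lq_setP //; apply: (lq_vars_regular P_bd P_ex _ _ Vs) => //.
- exact/us_min.
- exact/us_min.
(* a predecessor of u divides x_s u, and g(x_s u) comes no later *)
have [w [min_w lt_uw le_w]] : exists w,
    [/\ min_mon P w, lexlt u w & (w <= U_(s) + u)%MM].
  apply/(lex_colonP P_bd P_ex); first exact/us_min.
  by exists s => //; apply: lepm_refl.
have wus := (us_min w).2 min_w.
rewrite -us_lex // index_uniq //.
by apply: leq_ltn_trans (j_min w wus le_w) _; rewrite us_lex.
Qed.
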